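(* Let $n, d, d_k, m \ge 1$ and fix deterministic parameters $W_Q, W_K \in \mathbb{R}^{d\times d_k}$, $W_V \in \mathbb{R}^{d\times d}$, $W_1 \in \mathbb{R}^{m\times d}$, $b_1\in\mathbb{R}^m$, $W_2\in\mathbb{R}^{d\times m}$, $b_2\in\mathbb{R}^d$. For $x\in\mathbb{R}^{n\times d}$ let $\mathrm{Attn}(x) = \mathrm{softmax}\big((xW_Q)(xW_K)^\top/\sqrt{d_k}\big)\, x W_V$ (row-wise softmax), and for $y \in \mathbb{R}^d$ let $\mathrm{FFN}(y) = W_2\,\phi(W_1 y + b_1) + b_2$ where the GELU nonlinearity is replaced by its linearization $\phi(u) = \tfrac12 u$ (applied entrywise). Let $h^{(0)}\in\mathbb{R}^{n\times d}$ have independent rows $h^{(0)}_t \sim N(0,\sigma^2 I_d)$, let $\tilde h^{(0)} = h^{(0)} + \mathrm{Attn}(h^{(0)})$, and define the Transformer update for token $t$ by $F_{\mathrm{Trans},t} = \mathrm{Attn}(h^{(0)})_t + \mathrm{FFN}(\tilde h^{(0)}_t)$ (rows viewed as column vectors). Then for every $t$, $$\mu_{F,\mathrm{Trans}} := \mathbb{E}[F_{\mathrm{Trans},t}] = \tfrac12 W_2 b_1 + b_2.$$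
   Context: This is a one-layer Transformer block without layer normalization: $h^{(1)} = h^{(0)} + \mathrm{Attn}(h^{(0)}) + \mathrm{FFN}(h^{(0)}+\mathrm{Attn}(h^{(0)}))$, with FFN applied token-wise. Row-wise softmax: $\mathrm{softmax}(S)_{ij} = e^{S_{ij}}/\sum_k e^{S_{ik}}$. The paper's standing convention replaces $\mathrm{GELU}(u)$ by its first-order approximation $\tfrac12 u$. *)

(* Defs.v *)
From HB Require Import structures.
From mathcomp Require Import all_boot all_order all_algebra.
From mathcomp Require Import all_classical all_reals all_analysis.
Set Implicit Arguments. Unset Strict Implicit. Unset Printing Implicit Defensive.
Import Order.TTheory GRing.Theory Num.Theory.
Local Open Scope ring_scope.

Section Transformer.
Variable R : realType.

Definition softmax_rows (p q : nat) (S : 'M[R]_(p, q)) : 'M[R]_(p, q) :=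
  \matrix_(i, j) (expR (S i j) / \sum_(k < q) expR (S i k)).

Definition Attn (n d dk : nat) (WQ WK : 'M[R]_(d, dk)) (WV : 'M[R]_(d, d))
  (x : 'M[R]_(n, d)) : 'M[R]_(n, d) :=
  softmax_rows ((Num.sqrt (dk%:R))^-1 *: ((x *m WQ) *m (x *m WK)^T)) *m x *m WV.

(* GELU replaced by its linearization phi(u) = u/2, entrywise. *)
Definition phi_lin (m : nat) (u : 'cV[R]_m) : 'cV[R]_m := (2%:R)^-1 *: u.

Definition FFN (d m : nat) (W1 : 'M[R]_(m, d)) (b1 : 'cV[R]_m)
  (W2 : 'M[R]_(d, m)) (b2 : 'cV[R]_d) (y : 'cV[R]_d) : 'cV[R]_d :=
  W2 *m phi_lin (W1 *m y + b1) + b2.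

Definition F_trans (n d dk m : nat) (WQ WK : 'M[R]_(d, dk)) (WV : 'M[R]_(d, d))
  (W1 : 'M[R]_(m, d)) (b1 : 'cV[R]_m) (W2 : 'M[R]_(d, m)) (b2 : 'cV[R]_d)
  (t : 'I_n) (h : 'M[R]_(n, d)) : 'cV[R]_d :=
  (row t (Attn WQ WK WV h))^T + FFN W1 b1 W2 b2 (row t (h + Attn WQ WK WV h))^T.

End Transformer.

(* The entries of a random matrix H are independent N(0, sigma^2):
   each entry is measurable and the joint law is the product of the
   normal laws (product rule over all entries simultaneously; taking
   some B i j = setT gives the rule for every subfamily). *)
Definition iid_gaussian_entries (R : realType) (dT : measure_display)
  (T : measurableType dT) (P : probability T R) (n d : nat) (sigma : R)
  (H : T -> 'M[R]_(n, d)) : Prop :=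
  (forall i j, measurable_fun [set: T] (fun w => H w i j)) /\
  (forall B : 'I_n -> 'I_d -> set R, (forall i j, measurable (B i j)) ->
     P [set w : T | forall i j, B i j (H w i j)]%classic =
     (\prod_(i < n) \prod_(j < d) normal_prob 0 sigma (B i j))%E).

(* Main.v *)
(* Write F for the update and c = W2 b1 / 2 + b2. The attention weights are even
   in h (the scores are quadratic in h), so Attn is odd, and with the linearized
   GELU F - c is odd as well. The law of a centered Gaussian matrix is invariant
   under h |-> - h, because this holds on rectangles, which form a pi-system
   generating the product sigma-algebra; hence F - c has mean 0. Integrability
   holds because the weights lie in [0, 1] and Gaussians have a first moment. *)
Require Import Defs.
From HB Require Import structures.
From mathcomp Require Import all_boot all_order all_algebra.
From mathcomp Require Import all_classical all_reals all_analysis.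
From mathcomp Require Import measurable_realfun ring lra.
Import Order.TTheory GRing.Theory Num.Theory.
Local Open Scope ring_scope.

(** * Reflection and first moment of the centered normal law *)

Section Gaussian.
Local Open Scope classical_set_scope.
Context {R : realType}.
Local Notation mu := (@lebesgue_measure R).

(** Change of variables [y = - x]: the centered density is even and Lebesgue measure is invariant
    under negation. *)
Lemma normal_probN (s : R) (B : set R) : measurable B -> s != 0 ->
  normal_prob 0 s (-%R @^-1` B) = normal_prob 0 s B.
Proof.
move=> mB s0; rewrite /normal_prob.
transitivity (\int[mu]_(x in (-%R : R -> measurableTypeR R) @^-1` B)
    ((fun y => (normal_pdf 0 s y)%:E) \o -%R) x)%E.
  apply: eq_integral => x _ /=; congr EFin.
  by rewrite !normal_pdfE // /normal_fun !subr0 sqrrN.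
rewrite -ge0_integral_pushforward //=.
- by apply: eq_measure_integral => A mA _; exact: lebesgue_measureN.
- by apply/measurable_EFinP/measurable_funTS; exact: measurable_normal_pdf.
- by move=> x _; rewrite lee_fin normal_pdf_ge0.
Qed.

(** The Radon-Nikodym derivative of the normal law agrees almost everywhere with [normal_pdf], both
    having the same integral over every measurable set. *)
Lemma ge0_integral_normal_prob (m s : R) (f : R -> \bar R) :
  measurable_fun setT f -> (forall x, 0 <= f x)%E ->
  (\int[normal_prob m s]_x f x = \int[mu]_x (f x * (normal_pdf m s x)%:E))%E.
Proof.
move=> mf f0.
have dom := normal_prob_dominates m s.
rewrite -(Radon_Nikodym_SigmaFinite.change_of_variables dom) //.
have fint := Radon_Nikodym_SigmaFinite.f_integrable dom.
have mpdf : measurable_fun [set: R] (EFin \o normal_pdf m s).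
  by apply/measurable_EFinP; exact: measurable_normal_pdf.
apply: ae_eq_integral => //.
- by apply: emeasurable_funM => //; exact: (measurable_int mu).
- exact: emeasurable_funM.
- apply: ae_eqe_mul2l; apply: integral_ae_eq => // E _ mE.
  by rewrite -Radon_Nikodym_SigmaFinite.f_integral.
Qed.

Lemma integrable_normal_prob_id (s : R) : 0 < s ->
  (normal_prob 0 s).-integrable setT (EFin : R -> \bar R).
Proof.
move=> s0; have s1 : s != 0 by rewrite gt_eqF.
have s2 : s *+ 2 != 0 by rewrite mulrn_eq0.
apply/integrableP; split; first exact/measurable_EFinP.
rewrite ge0_integral_normal_prob //; last exact: measurableT_comp.
(* The density with standard deviation 2s absorbs the factor |x|. *)
pose C := (1 + 4 * s ^+ 2) * (normal_peak s / normal_peak (s *+ 2)).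
have := integrableZl measurableT C (integrable_normal_pdf 0 (s *+ 2)).
move=> /integrableP[_]; apply: le_lt_trans; apply: ge0_le_integral => //.
- by move=> x _; rewrite mule_ge0 // lee_fin normal_pdf_ge0.
- apply: emeasurable_funM; first exact: measurableT_comp.
  by apply/measurable_EFinP; exact: measurable_normal_pdf.
- apply: measurableT_comp => //; apply/measurable_funeM/measurable_EFinP.
  exact: measurable_normal_pdf.
move=> x _ /=; rewrite lee_fin; apply: le_trans (ler_norm _).
rewrite !normal_pdfE // /C -!mulrA (mulrCA _ (normal_peak s)).
rewrite (mulrCA (1 + _)) ler_wpM2l ?normal_peak_ge0 //.
rewrite mulKf ?gt_eqF ?normal_peak_gt0 // /normal_fun !subr0.
(* Once the peaks cancel, the density for [s] has exponent [- b *+ 4] and the wider one [- b], so a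
   spare factor [expR (b *+ 3)] remains to dominate [|x|]. *)
set b := x ^+ 2 / ((s *+ 2) ^+ 2 *+ 2).
have -> : - x ^+ 2 / (s ^+ 2 *+ 2) = - b *+ 4.
  by rewrite /b; field.
rewrite mulNr -/b.
have b0 : 0 <= b by rewrite divr_ge0 ?mulrn_wge0 ?sqr_ge0.
have bx : x ^+ 2 = 8 * s ^+ 2 * b by rewrite /b; field.
have eb : 1 + b <= expR (b *+ 3).
  by apply: le_trans (expR_ge1Dx _) _; rewrite ler_expR; lra.
have -> : - b *+ 4 = - (b *+ 3) - b by lra.
rewrite expRD mulrA ler_wpM2r ?expR_ge0 // expRN ler_pdivrMr ?expR_gt0 //.
(* From [(|x| - 1) ^+ 2 >= 0] comes [|x| <= (1 + x ^+ 2) / 2], which is then expressed through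
   [b]. *)
have x1 : `|x| <= 2^-1 + 4 * s ^+ 2 * b.
  have := sqr_ge0 (`|x| - 1); rewrite sqrrB1 real_normK ?num_real // bx; lra.
have s20 := sqr_ge0 s.
have C0 : 0 <= 1 + 4 * s ^+ 2 by lra.
apply: le_trans (ler_wpM2l C0 eb); apply: le_trans x1 _.
by rewrite mulrDr mulr1 mulrDl mul1r; lra.
Qed.
End Gaussian.

(** * The product sigma-algebra on matrices *)

Definition matrix_space (R : realType) (n d : nat) : Type := 'M[R]_(n, d).

Section MatrixSigmaAlgebra.
Local Open Scope classical_set_scope.
Context {R : realType} {n d : nat}.

(** These are exactly the sets on which [iid_gaussian_entries] prescribes the law of [H]. *)
Definition matrix_rectangles : set (set (matrix_space R n d)) :=
  [set A | exists2 B : 'I_n -> 'I_d -> set R,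
     (forall i j, measurable (B i j)) &
     A = [set x : 'M[R]_(n, d) | forall i j, B i j (x i j)]].

(** The instances are attached to the alias [matrix_space], so the matrix type itself is left
    without a new measurable structure. *)
HB.instance Definition _ := Choice.copy (matrix_space R n d) 'M[R]_(n, d).
HB.instance Definition _ := isPointed.Build (matrix_space R n d) (0 : 'M[R]_(n, d)).
HB.instance Definition _ := @isMeasurable.Build (sigma_display matrix_rectangles)
  (matrix_space R n d) <<s matrix_rectangles >>
  (@sigma_algebra0 _ setT matrix_rectangles) (@sigma_algebraC _ matrix_rectangles)
  (@sigma_algebra_bigcup _ setT matrix_rectangles).

Lemma matrix_rectanglesI : setI_closed matrix_rectangles.
Proof.
move=> _ _ [B mB ->] [C mC ->].
exists (fun i j => B i j `&` C i j); first by move=> i j; exact: measurableI.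
by apply/seteqP; split=> x /=;
  [move=> [Bx Cx] i j; split|move=> BCx; split=> i j; have [] := BCx i j].
Qed.

Lemma measurable_fun_entry (i : 'I_n) (j : 'I_d) :
  measurable_fun setT (fun x : matrix_space R n d => (x : 'M[R]_(n, d)) i j).
Proof.
move=> _ B mB; rewrite setTI; apply: sub_sigma_algebra.
exists (fun k l => if (k == i) && (l == j) then B else setT).
  by move=> k l; case: ifP.
apply/seteqP; split=> x /=.
  by move=> Bx k l; case: ifP => // /andP[/eqP-> /eqP->].
by move=> /(_ i j); rewrite !eqxx.
Qed.

(** It suffices to test generators, and the preimage of a rectangle is a finite intersection of
    preimages under the entries. *)
Lemma measurable_fun_matrix (dT : measure_display) (T : measurableType dT)
    (X : T -> 'M[R]_(n, d)) :
  (forall i j, measurable_fun setT (fun w => X w i j)) ->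
  measurable_fun setT (X : T -> matrix_space R n d).
Proof.
move=> mX.
apply: (@measurability _ _ T (matrix_space R n d) setT X matrix_rectangles) => //.
move=> _ [_ [B mB ->] <-]; rewrite setTI.
rewrite (_ : _ @^-1` _ = \bigcap_(i : 'I_n) \bigcap_(j : 'I_d)
    (setT `&` (fun w => X w i j) @^-1` B i j)).
  apply: fin_bigcap_measurable => // i _; apply: fin_bigcap_measurable => // j _.
  exact: mX.
apply/seteqP; split=> w /=; first by move=> Bw i _ j _; split=> //=; exact: Bw.
by move=> Bw i j; have [] := Bw i I j I.
Qed.

End MatrixSigmaAlgebra.

(** * Sign symmetry of the Gaussian matrix *)

Section Symmetry.
Local Open Scope classical_set_scope.
Context {R : realType} {dT : measure_display} {T : measurableType dT}
  {P : probability T R} {n d : nat} {sigma : R} {H : T -> 'M[R]_(n, d)}.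
Hypotheses (s0 : 0 < sigma) (hH : iid_gaussian_entries P sigma H).
Local Notation MT := (matrix_space R n d).

Let mH : measurable_fun setT (H : T -> MT).
Proof. exact: measurable_fun_matrix hH.1. Qed.

Let mHN : measurable_fun setT ((fun w => - H w) : T -> MT).
Proof.
apply: measurable_fun_matrix => i j; under eq_fun do rewrite mxE.
exact: (measurable_funN (hH.1 i j)).
Qed.

(** Packing [H] and [- H] as random variables gives access to their laws through [distribution]. *)
Let HX : {RV P >-> MT} :=
  HB.pack (H : T -> MT) (isMeasurableFun.Build _ _ _ _ _ mH).
Let HXN : {RV P >-> MT} :=
  HB.pack ((fun w => - H w) : T -> MT) (isMeasurableFun.Build _ _ _ _ _ mHN).

Lemma gaussian_matrixN (A : set MT) : measurable A ->
  P (H @^-1` A) = P ((fun w => - H w) @^-1` A).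
Proof.
move: A; apply: (measure_unique matrix_rectangles (fun=> setT) _ _ _ _
  (distribution P HX) (distribution P HXN)) => //.
- exact: matrix_rectanglesI.
- move=> _; exists (fun _ _ => setT) => //.
  by apply/seteqP; split.
- by rewrite bigcup_const //; exists 0%N.
- move=> _ [B mB ->]; rewrite /distribution /pushforward /=.
  have mNB i j : measurable (-%R @^-1` B i j).
    rewrite -[X in measurable X]setTI.
    exact: oppr_measurable.
  (* Each factor is reflected by [normal_probN]; the product rule is then read backwards on the
     rectangle of reflected sets, whose preimage under [H] is that of the original under [- H]. *)
  transitivity (\prod_(i < n) \prod_(j < d) normal_prob 0 sigma (B i j))%E.
    exact: hH.2.
  transitivity
    (\prod_(i < n) \prod_(j < d) normal_prob 0 sigma (-%R @^-1` B i j))%E.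
    apply: eq_bigr => i _; apply: eq_bigr => j _.
    by rewrite normal_probN // gt_eqF.
  rewrite -hH.2 //; congr (P _); apply/seteqP.
  by split=> w /= Bw i j; move: (Bw i j); rewrite mxE.
- move=> _ /=.
  by rewrite /distribution /pushforward preimage_setT probability_setT ltry.
Qed.

(** Equality of the laws of [H] and [- H] equates the means of [f (H w)] and [f (- H w)], and
    oddness makes the second the opposite of the first. *)
Lemma integral_gaussian_odd (f : 'M[R]_(n, d) -> R) :
  measurable_fun setT (f : MT -> R) -> (forall x, f (- x) = - f x) ->
  P.-integrable setT (fun w => (f (H w))%:E) ->
  (\int[P]_w (f (H w))%:E = 0)%E.
Proof.
move=> mf fN intf.
have mEf : measurable_fun setT (EFin \o f : MT -> \bar R).
  exact/measurable_EFinP.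
have intN : P.-integrable setT (fun w => (f (- H w))%:E).
  apply: (eq_integrable measurableT _ _ _ (integrableN intf)) => w _ /=.
  by rewrite fN.
have : (\int[P]_w (f (H w))%:E = \int[P]_w (f (- H w))%:E)%E.
  rewrite -[LHS](integral_distribution (X := HX) mEf intf).
  rewrite -[RHS](integral_distribution (X := HXN) mEf intN).
  by apply: eq_measure_integral => A mA _; exact: gaussian_matrixN.
under [in X in _ = X -> _]eq_integral do rewrite fN EFinN.
rewrite integralN; last first.
  exact: integrable_add_def.
(* Integrability makes the mean finite, so that [x = - x] can be solved in the reals. *)
have /fineK <- := integrable_fin_num measurableT intf.
by move=> [e]; congr EFin; lra.
Qed.

Lemma gaussian_entry_integrable i j : P.-integrable setT (fun w => (H w i j)%:E).
Proof.
have mij : measurable_fun setT (fun w => H w i j : measurableTypeR R) := hH.1 i j.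
pose X : {RV P >-> measurableTypeR R} := HB.pack (fun w => H w i j : measurableTypeR R)
  (isMeasurableFun.Build _ _ _ _ _ mij).
have lawX B : measurable B -> distribution P X B = normal_prob 0 sigma B.
  (* The marginal is read off the joint law: [setT] at every other entry contributes a factor 1. *)
  move=> mB; pose C k l := if (k == i) && (l == j) then B else setT.
  transitivity (P [set w : T | forall k l, C k l (H w k l)]).
    rewrite /distribution /pushforward; congr (P _).
    apply/seteqP; split=> w /=; last by move=> /(_ i j); rewrite /C !eqxx.
    by move=> Bx k l; rewrite /C; case: ifP => // /andP[/eqP-> /eqP->].
  rewrite hH.2; last by move=> k l; rewrite /C; case: ifP.
  rewrite (bigD1 i) //= (bigD1 j) //= {1}/C !eqxx /= big1 => [|l /negPf lj].
    rewrite mule1 big1 ?mule1 // => k /negPf ki; rewrite big1 // => l _.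
    by rewrite /C ki probability_setT.
  by rewrite /C lj andbF probability_setT.
have mabs : measurable_fun setT (fun x : measurableTypeR R => `|x%:E|%E).
  by apply: measurableT_comp => //; exact/measurable_EFinP.
have eX : (\int[distribution P X]_x `|x%:E| = \int[normal_prob 0 sigma]_x `|x%:E|)%E.
  by apply: eq_measure_integral => B mB _; exact: lawX.
apply/integrableP; split; first exact/measurable_EFinP.
have /integrableP[_] := integrable_normal_prob_id _ s0.
rewrite -eX (ge0_integral_distribution X mabs) // => x; exact: abse_ge0.
Qed.
End Symmetry.

(** * Closure rules for odd integrable functions *)

Section OddIntegrable.
Local Open Scope classical_set_scope.
Context {R : realType} {dT : measure_display} {T : measurableType dT}
  (P : probability T R) {n d : nat} (H : T -> 'M[R]_(n, d)).
Local Notation MT := (matrix_space R n d).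

(** Bundles what [integral_gaussian_odd] asks of [f], so that the update can be assembled from
    single entries by closure rules. *)
Definition odd_integrable (f : 'M[R]_(n, d) -> R) : Prop :=
  [/\ measurable_fun setT (f : MT -> R), forall x, f (- x) = - f x &
      P.-integrable setT (fun w => (f (H w))%:E)].

Lemma odd_integrableZl (k : R) f :
  odd_integrable f -> odd_integrable (fun x => k * f x).
Proof.
move=> [mf fN intf]; split.
- by apply: measurable_funM.
- by move=> x; rewrite fN mulrN.
- exact: (integrableZl measurableT k intf).
Qed.

Lemma odd_integrableD f g :
  odd_integrable f -> odd_integrable g -> odd_integrable (fun x => f x + g x).
Proof.
move=> [mf fN intf] [mg gN intg]; split.
- exact: measurable_funD.
- by move=> x; rewrite fN gN opprD.
- exact: (integrableD measurableT intf intg).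
Qed.

Lemma odd_integrable_sum (I : finType) (f : I -> 'M[R]_(n, d) -> R) :
  (forall i, odd_integrable (f i)) -> odd_integrable (fun x => \sum_i f i x).
Proof.
move=> fi; split.
- by apply: measurable_sum => i; have [] := fi i.
- move=> x; rewrite -sumrN; apply: eq_bigr => i _.
  by have [_ fN _] := fi i; rewrite fN.
- under eq_fun do rewrite -sumEFin.
  by apply: (integrable_sum measurableT) => i _; have [] := fi i.
Qed.

(** Meant for [g] an attention weight: the bound on [g] lets [f] dominate the product. *)
Lemma odd_integrableM_even (g f : 'M[R]_(n, d) -> R) :
  measurable_fun setT (H : T -> MT) ->
  measurable_fun setT (g : MT -> R) ->
  (forall x, g (- x) = g x) -> (forall x, `|g x| <= 1) ->
  odd_integrable f -> odd_integrable (fun x => g x * f x).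
Proof.
move=> mH mg gN g1 [mf fN intf].
have mgf : measurable_fun setT (fun x : MT => g x * f x) by exact: measurable_funM.
split=> // [x|]; first by rewrite gN fN mulrN.
apply: le_integrable intf => //.
  by apply/measurable_EFinP; exact: (measurableT_comp mgf mH).
by move=> w _; rewrite lee_fin normrM ler_piMl.
Qed.

End OddIntegrable.

(** * Parity, boundedness and measurability of the attention weights *)

Section Attention.
Local Open Scope classical_set_scope.
Context {R : realType} {n d dk : nat}.
Variables (WQ WK : 'M[R]_(d, dk)) (WV : 'M[R]_d).
Local Notation MT := (matrix_space R n d).

Definition attn_weights (x : 'M[R]_(n, d)) : 'M[R]_n :=
  softmax_rows ((Num.sqrt dk%:R)^-1 *: ((x *m WQ) *m (x *m WK)^T)).

Lemma AttnE x : Attn WQ WK WV x = attn_weights x *m x *m WV.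
Proof. by []. Qed.

Lemma attn_weightsN x : attn_weights (- x) = attn_weights x.
Proof. by rewrite /attn_weights !mulNmx [(- _)^T]linearN mulmxN opprK. Qed.

(** The numerator is one of the positive terms summed in the denominator. *)
Lemma softmax_rows_norm_le1 (p q : nat) (S : 'M[R]_(p, q)) i j :
  `|softmax_rows S i j| <= 1.
Proof.
have e0 k : 0 <= expR (S i k) by exact: expR_ge0.
have Sj : expR (S i j) <= \sum_k expR (S i k).
  by rewrite (bigD1 j) //= lerDl sumr_ge0.
have S0 : 0 < \sum_k expR (S i k) by apply: lt_le_trans Sj; exact: expR_gt0.
by rewrite mxE ger0_norm ?divr_ge0 ?(ltW S0) // ler_pdivrMr // mul1r.
Qed.

Lemma measurable_mulmx_entry (dT : measure_display) (T : measurableType dT)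
    (p q r : nat) (X : T -> 'M[R]_(p, q)) (Y : T -> 'M[R]_(q, r)) :
  (forall i j, measurable_fun setT (fun w => X w i j)) ->
  (forall i j, measurable_fun setT (fun w => Y w i j)) ->
  forall i j, measurable_fun setT (fun w => (X w *m Y w) i j).
Proof.
move=> mX mY i j; under eq_fun do rewrite mxE.
by apply: measurable_sum => k; exact: measurable_funM.
Qed.

Lemma measurable_softmax_rows (dT : measure_display) (T : measurableType dT)
    (p q : nat) (X : T -> 'M[R]_(p, q)) :
  (forall i j, measurable_fun setT (fun w => X w i j)) ->
  forall i j, measurable_fun setT (fun w => softmax_rows (X w) i j).
Proof.
move=> mX i j.
(* expR a / Z = expR (a - ln Z) reduces the quotient to measurability of ln. *)
rewrite (_ : (fun w => _) =
    (fun w => expR (X w i j - ln (\sum_k expR (X w i k))))).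
  apply: measurableT_comp => //; apply: measurable_funB => //.
  apply: measurableT_comp => //; apply: measurable_sum => k.
  exact: measurableT_comp.
apply/funext => w; rewrite mxE expRD expRN lnK // posrE.
by rewrite (bigD1 j) //= ltr_wpDr ?expR_gt0 // sumr_ge0 // => k _; exact: expR_ge0.
Qed.

Lemma measurable_attn_weights i j :
  measurable_fun setT (fun x : MT => attn_weights x i j).
Proof.
apply: measurable_softmax_rows => k l; under eq_fun do rewrite mxE.
apply: measurable_funM => //; apply: measurable_mulmx_entry => a b.
  apply: measurable_mulmx_entry => // a' b'; exact: measurable_fun_entry.
under eq_fun do rewrite mxE.
apply: measurable_mulmx_entry => // a' b'; exact: measurable_fun_entry.
Qed.

End Attention.

(** * The update as an odd part plus a constant, and its mean *)

Lemma F_trans_split (R : realType) (n d dk m : nat)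
  (WQ WK : 'M[R]_(d, dk)) (WV : 'M[R]_(d, d))
  (W1 : 'M[R]_(m, d)) (b1 : 'cV[R]_m) (W2 : 'M[R]_(d, m)) (b2 : 'cV[R]_d)
  (t : 'I_n) (j : 'I_d) (x : 'M[R]_(n, d)) :
  F_trans WQ WK WV W1 b1 W2 b2 t x j 0 =
    (Attn WQ WK WV x t j +
     \sum_k (2^-1 *: (W2 *m W1)) j k * (x t k + Attn WQ WK WV x t k))
    + (2^-1 *: (W2 *m b1) + b2) j 0.
Proof.
(* The linearized FFN is affine: its linear part has matrix [2^-1 *: (W2 *m W1)], and all terms free
   of [x] are gathered at the end. *)
have -> : F_trans WQ WK WV W1 b1 W2 b2 t x =
  ((row t (Attn WQ WK WV x))^T +
   2^-1 *: (W2 *m W1) *m (row t (x + Attn WQ WK WV x))^T)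
  + (2^-1 *: (W2 *m b1) + b2).
  rewrite /F_trans /FFN /phi_lin -scalemxAr mulmxDr mulmxA scalerDr scalemxAl.
  by rewrite !addrA.
rewrite mxE [X in X + _]mxE; congr (_ + _ + _); first by rewrite !mxE.
by rewrite mxE; apply: eq_bigr => k _; rewrite [in RHS]/= !mxE.
Qed.

Theorem theorem1 (R : realType) (n d dk m : nat)
  (hn : (0 < n)%N) (hd : (0 < d)%N) (hdk : (0 < dk)%N) (hm : (0 < m)%N)
  (WQ WK : 'M[R]_(d, dk)) (WV : 'M[R]_(d, d))
  (W1 : 'M[R]_(m, d)) (b1 : 'cV[R]_m) (W2 : 'M[R]_(d, m)) (b2 : 'cV[R]_d)
  (sigma : R) (hsigma : 0 < sigma)
  (dT : measure_display) (T : measurableType dT) (P : probability T R)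
  (H : T -> 'M[R]_(n, d))
  (hH : iid_gaussian_entries P sigma H) :
  forall (t : 'I_n) (j : 'I_d),
    P.-integrable [set: T]
      (fun w => ((F_trans WQ WK WV W1 b1 W2 b2 t (H w)) j 0)%:E) /\
    (\int[P]_w ((F_trans WQ WK WV W1 b1 W2 b2 t (H w)) j 0)%:E
      = (((2%:R)^-1 *: (W2 *m b1) + b2) j 0)%:E)%E.
Proof.
move=> t j.
have mH : measurable_fun setT (H : T -> matrix_space R n d).
  exact: measurable_fun_matrix hH.1.
have oddH i k : odd_integrable P H (fun x => x i k).
  split; first exact: measurable_fun_entry.
    by move=> x; rewrite mxE.
  exact: gaussian_entry_integrable hsigma hH i k.
have oddA k : odd_integrable P H (fun x => Attn WQ WK WV x t k).
  (* Attention is expanded with the fixed coefficients [WV l k] outside, leaving products of a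
     bounded even weight and an odd entry. *)
  rewrite (_ : (fun x => _) = fun x => \sum_l WV l k *
      \sum_i attn_weights WQ WK x t i * x i l).
    apply: odd_integrable_sum => l; apply/odd_integrableZl/odd_integrable_sum => i.
    apply: (odd_integrableM_even P H (fun x => attn_weights WQ WK x t i) _ mH).
    - exact: measurable_attn_weights.
    - by move=> x; rewrite attn_weightsN.
    - by move=> x; exact: softmax_rows_norm_le1.
    - exact: oddH.
  apply/funext => x; rewrite AttnE mxE; apply: eq_bigr => l _.
  by rewrite mxE mulrC.
pose G x := Attn WQ WK WV x t j +
  \sum_k (2^-1 *: (W2 *m W1)) j k * (x t k + Attn WQ WK WV x t k).
have [mG GN intG] : odd_integrable P H G.
  apply: odd_integrableD => //; apply: odd_integrable_sum => k.
  exact/odd_integrableZl/odd_integrableD.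
have FE w : (F_trans WQ WK WV W1 b1 W2 b2 t (H w) j 0)%:E =
    ((G (H w))%:E + ((2^-1 *: (W2 *m b1) + b2) j 0)%:E)%E.
  by rewrite F_trans_split.
have intc : P.-integrable setT (fun=> ((2^-1 *: (W2 *m b1) + b2) j 0)%:E).
  exact: finite_measure_integrable_cst.
under eq_fun do rewrite FE.
split; first exact: (integrableD measurableT intG intc).
rewrite (integralD measurableT intG intc).
rewrite (integral_gaussian_odd hsigma hH G mG GN intG) add0e integral_cst //.
(* The constant integrates to itself because [P] has total mass 1. *)
by rewrite -[RHS]mule1; congr (_ * _)%E; exact: probability_setT.
Qed.
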